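(* Let $A\in\mathbb{C}^{n\times n}$, $B\in\mathbb{C}^{m\times m}$ and $C\in\mathbb{C}^{n\times m}$, and suppose that $\mathrm{eig}(A)\cap\mathrm{eig}(-B)=\emptyset$. Let $\mathcal{L}:\mathbb{C}^{n\times m}\to\mathbb{C}^{n\times m}$ be the Sylvester operator $\mathcal{L}(X):=AX+XB$. Moreover, let matrices $E_k\in\mathbb{C}^{n\times m}$ and linear functionals $\mathcal{W}_k:\mathbb{C}^{n\times m}\to\mathbb{C}$ be given for $k=1,2,\dots,N$, and define $\Pi:\mathbb{C}^{n\times m}\to\mathbb{C}^{n\times m}$ by $$\Pi(X):=\sum_{k=1}^N\mathcal{W}_k(X)E_k.$$ Assume that there exists a unique solution $X$ to the equation $$\mathcal{L}(X)+\Pi(X)=C.$$ Let $G:=\mathcal{L}^{-1}(C)$ and $F_k:=\mathcal{L}^{-1}(E_k)$ for $k=1,2,\dots,N$, and define $$W:=\begin{pmatrix}1+\mathcal{W}_1(F_1)&\mathcal{W}_1(F_2)&\cdots&\mathcal{W}_1(F_N)\\ \mathcal{W}_2(F_1)&1+\mathcal{W}_2(F_2)&\cdots&\mathcal{W}_2(F_N)\\ \vdots&\vdots&\ddots&\vdots\\ \mathcal{W}_N(F_1)&\mathcal{W}_N(F_2)&\cdots&1+\mathcal{W}_N(F_N)\end{pmatrix},\qquad g:=\begin{pmatrix}\mathcal{W}_1(G)\\ \mathcal{W}_2(G)\\ \vdots\\ \mathcal{W}_N(G)\end{pmatrix}.$$ Then the solution to $\mathcal{L}(X)+\Pi(X)=C$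 is given by $$X=\mathcal{L}^{-1}\left(C-\sum_{k=1}^N\alpha_kE_k\right),$$ where $a^T=(\alpha_1,\dots,\alpha_N)$ is the unique solution to the linear system of equations $Wa=g$.
   Context: $\mathrm{eig}(A)$ denotes the set of eigenvalues of the matrix $A$. The condition $\mathrm{eig}(A)\cap\mathrm{eig}(-B)=\emptyset$ ensures that the Sylvester operator $\mathcal{L}$ is invertible, and $\mathcal{L}^{-1}$ denotes its inverse. *)

(* Defs.v *)
From HB Require Import structures.
From mathcomp Require Import all_boot all_order all_algebra.
From mathcomp Require Import complex.
From mathcomp Require Import classical_sets reals.

Set Implicit Arguments.
Unset Strict Implicit.
Unset Printing Implicit Defensive.

Import GRing.Theory.
Local Open Scope ring_scope.
Local Open Scope classical_set_scope.

(* [eigenvalue] is phrased with row eigenvectors, [v *m A = a *: v]; the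
   spectrum is the same as for column eigenvectors. *)
Definition eig (F : fieldType) (n : nat) (A : 'M[F]_n) : set F :=
  [set a | eigenvalue A a].

Section Sylvester.
Variables (F : fieldType) (n m : nat) (A : 'M[F]_n) (B : 'M[F]_m).

Definition sylvester (X : 'M[F]_(n, m)) : 'M[F]_(n, m) := A *m X + X *m B.

Fact sylvester_is_linear : linear sylvester.
Proof.
move=> a X Y; rewrite /sylvester mulmxDr mulmxDl -scalemxAr -scalemxAl.
by rewrite scalerDr addrACA.
Qed.

HB.instance Definition _ :=
  GRing.isLinear.Build F 'M[F]_(n, m) 'M[F]_(n, m) _ sylvester
    sylvester_is_linear.

(* [(_)^-1%VF] is total; it is the two-sided inverse as soon as [sylvester] is
   injective: see [sylvesterK] and [sylvester_invK] below. *)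
Definition sylvester_inv : 'M[F]_(n, m) -> 'M[F]_(n, m) :=
  (linfun sylvester)^-1%VF.

Lemma sylvesterK : injective sylvester -> cancel sylvester sylvester_inv.
Proof.
move=> inj X; rewrite /sylvester_inv -[sylvester X]lfunE lker0_lfunK //.
by apply/lker0P => Y Z; rewrite !lfunE => /inj.
Qed.

Lemma sylvester_invK : injective sylvester -> cancel sylvester_inv sylvester.
Proof.
move=> inj X; rewrite /sylvester_inv -[RHS](@lker0_lfunVK _ _ (linfun sylvester)) ?lfunE //.
by apply/lker0P => Y Z; rewrite !lfunE => /inj.
Qed.

End Sylvester.

Section LowRankPerturbation.
Variables (F : fieldType) (n m N : nat).
Variables (Wf : 'I_N -> {scalar 'M[F]_(n, m)}).

Definition lowrank_op (E : 'I_N -> 'M[F]_(n, m)) (X : 'M[F]_(n, m)) :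
  'M[F]_(n, m) := \sum_k Wf k X *: E k.

Definition coupling_mx (S : 'I_N -> 'M[F]_(n, m)) : 'M[F]_N :=
  \matrix_(i, j) ((i == j)%:R + Wf i (S j)).

Definition functional_col (X : 'M[F]_(n, m)) : 'cV[F]_N := \col_i Wf i X.

End LowRankPerturbation.

(* Main.v *)
(** If [A *m X = X *m (- B)] with [X != 0], a rank factorization [X = U *m V]
    gives [A *m U = U *m T] and [V *m (- B) = T *m V] for one matrix [T], any
    eigenvalue of which lies in both spectra; hence the Sylvester operator is injective.
    Writing [L] for it and [Pi] for the perturbation, [W *m b = 0] makes
    [Y := \sum_k b_k F_k] satisfy [L Y + Pi Y = 0], so [Y = 0] by uniqueness of
    the solution, and then [b = 0]: [W] is invertible.  If [X] is the solution,
    applying the functionals to [X = G - \sum_k Wf_k(X) F_k] shows that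
    [a_k := Wf_k(X)] solves [W *m a = g]. *)
From HB Require Import structures.
Require Import Defs.
From mathcomp Require Import all_boot all_order all_algebra.
From mathcomp Require Import complex.
From mathcomp Require Import classical_sets reals.

Set Implicit Arguments.
Unset Strict Implicit.
Unset Printing Implicit Defensive.

Import GRing.Theory.
Local Open Scope ring_scope.
Local Open Scope classical_set_scope.

(** Determinants are invariant under transposition, hence so are characteristic polynomials. This
    lets column eigenvectors stand in for the row eigenvectors of [eigenvalue]. *)
Lemma eigenvalue_trmx (F : fieldType) (n : nat) (A : 'M[F]_n) (a : F) :
  eigenvalue A^T a = eigenvalue A a.
Proof.
rewrite !eigenvalue_root_char; congr (root _ a).
by rewrite /char_poly -det_tr /char_poly_mx linearB /= tr_scalar_mx map_trmx trmxK.
Qed.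

(** A row eigenvector [w] of [T] is carried to [w *m V], which is nonzero because the rows of [V]
    are independent. *)
Lemma eigenvalue_intertwine (F : fieldType) (r m : nat) (T : 'M[F]_r)
    (B : 'M[F]_m) (V : 'M[F]_(r, m)) (a : F) :
  row_free V -> V *m B = T *m V -> eigenvalue T a -> eigenvalue B a.
Proof.
move=> freeV VB /eigenvalueP[w wT w0]; apply/eigenvalueP; exists (w *m V).
  by rewrite -mulmxA VB mulmxA wT scalemxAl.
by rewrite mulmx_free_eq0.
Qed.

Lemma sylvester_inj (F : numClosedFieldType) (n m : nat)
    (A : 'M[F]_n) (B : 'M[F]_m) :
  eig A `&` eig (- B) = set0 -> injective (sylvester A B).
Proof.
move=> disj; apply: raddf_inj => X /eqP; rewrite addr_eq0 -mulmxN => /eqP AX.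
apply/eqP; rewrite -mxrank_eq0; apply: contraT; rewrite -lt0n => r_gt0.
pose U := col_base X; pose V := row_base X.
have UV : U *m V = X by exact: mulmx_base.
have freeV : row_free V by exact: row_base_free.
(* The row space of [X] is stable under [- B], because [X *m (- B) = A *m X]; [T] is the matrix of
   the restriction in the basis [V]. *)
have /submxP[T VB] : (V *m - B <= V)%MS.
  by rewrite (eqmxMr _ (eq_row_base X)) eq_row_base -AX submxMl.
have fullU : row_full U by exact: col_base_full.
clearbody U V.
(* After multiplication by [V] on the right, which can be cancelled, both sides are [A *m X]. *)
have AU : A *m U = U *m T.
  apply: (row_free_inj freeV).
  by rewrite -!mulmxA -VB UV AX mulmxA UV.
(* [T] has size [\rank X > 0], so over a closed field it has an eigenvalue. *)
have [a Ta] := eigenvalue_closed T r_gt0.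
suff : (eig A `&` eig (- B)) a by rewrite disj.
split; last exact: eigenvalue_intertwine VB Ta.
(* On the side of [A] the intertwiner [U] acts on columns; transposing makes it row free and puts it
   on the left. *)
rewrite /eig /= -eigenvalue_trmx.
apply: (@eigenvalue_intertwine _ _ _ T^T _ U^T); rewrite ?eigenvalue_trmx //.
  by rewrite /row_free mxrank_tr -/(row_full U).
by rewrite -!trmx_mul AU.
Qed.

Lemma sylvester_inv_linear (F : fieldType) (n m : nat)
    (A : 'M[F]_n) (B : 'M[F]_m) : linear (sylvester_inv A B).
Proof. by move=> c X Y; rewrite /sylvester_inv linearP. Qed.

HB.instance Definition _ (F : fieldType) (n m : nat)
    (A : 'M[F]_n) (B : 'M[F]_m) :=
  GRing.isLinear.Build F 'M[F]_(n, m) 'M[F]_(n, m) _ (sylvester_inv A B)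
    (sylvester_inv_linear A B).

(** Linearity of the functionals collects everything outside the identity part into their values at
    one matrix, so entries of [W] need not be handled again. *)
Lemma coupling_mxE (F : fieldType) (n m N : nat)
    (Wf : 'I_N -> {scalar 'M[F]_(n, m)}) (S : 'I_N -> 'M[F]_(n, m))
    (b : 'cV[F]_N) :
  coupling_mx Wf S *m b = b + functional_col Wf (\sum_k b k 0 *: S k).
Proof.
apply/colP => i; rewrite !mxE linear_sum /=.
under eq_bigr => j _ do rewrite mxE mulrDl.
rewrite big_split /= (bigD1 i) //= eqxx mul1r big1 ?addr0; last first.
  by move=> j ji; rewrite eq_sym (negbTE ji) mul0r.
by congr (_ + _); apply: eq_bigr => j _; rewrite linearZ /= mulrC.
Qed.

Section LinearPerturbation.
Variables (F : numClosedFieldType) (n m N : nat).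
Variables (A : 'M[F]_n) (B : 'M[F]_m).
Variables (Wf : 'I_N -> {scalar 'M[F]_(n, m)}) (E : 'I_N -> 'M[F]_(n, m)).
Hypothesis disj : eig A `&` eig (- B) = set0.

Local Notation L := (sylvester A B).
Local Notation Linv := (sylvester_inv A B).
Local Notation W := (coupling_mx Wf (fun k => Linv (E k))).

Lemma sylvester_inv_sum (b : 'I_N -> F) :
  Linv (\sum_k b k *: E k) = \sum_k b k *: Linv (E k).
Proof. by rewrite linear_sum; apply: eq_bigr => k _; rewrite linearZ. Qed.

Lemma lowrank_op_is_linear : linear (lowrank_op Wf E).
Proof.
move=> c X Y; rewrite /lowrank_op scaler_sumr -big_split /=.
by apply: eq_bigr => k _; rewrite linearP /= scalerDl scalerA.
Qed.

HB.instance Definition _ :=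
  GRing.isLinear.Build F 'M[F]_(n, m) 'M[F]_(n, m) _ (lowrank_op Wf E)
    lowrank_op_is_linear.

Lemma coupling_mx_inj :
  (forall Y, L Y + lowrank_op Wf E Y = 0 -> Y = 0) ->
  injective (mulmx W : 'cV[F]_N -> 'cV[F]_N).
Proof.
move=> ker0; apply: raddf_inj => b /=; rewrite coupling_mxE.
set Y := \sum_k _ => bY.
suff Y0 : Y = 0.
  apply/colP => i; move/colP/(_ i): bY.
  by rewrite Y0 !mxE linear0 addr0.
(* [L Y] is the combination of the [E k] with coefficients [b k], while [bY] says that [Wf k Y] is
   [- b k]: the two sums cancel termwise. *)
apply: ker0; rewrite /Y -sylvester_inv_sum sylvester_invK; last exact: sylvester_inj.
rewrite sylvester_inv_sum -/Y -big_split big1 // => k _ /=.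
by move/colP/(_ k): bY; rewrite !mxE -scalerDl => ->; rewrite scale0r.
Qed.

Lemma perturbed_solution (C X : 'M[F]_(n, m)) :
  L X + lowrank_op Wf E X = C ->
  X = Linv (C - \sum_k functional_col Wf X k 0 *: E k) /\
  W *m functional_col Wf X = functional_col Wf (Linv C).
Proof.
move=> LX; have XE : X = Linv (C - \sum_k functional_col Wf X k 0 *: E k).
  rewrite -LX /lowrank_op; under [X in _ - X]eq_bigr do rewrite mxE.
  by rewrite addrK sylvesterK //; exact: sylvester_inj.
split=> //; rewrite coupling_mxE.
move: XE; rewrite linearB /= sylvester_inv_sum; set Z := \sum_k _ => XE.
(* With [Z] the combination of the [Linv (E k)] weighted by [Wf k X], both sides become the column
   of values [Wf i X + Wf i Z]. *)
have -> : Linv C = X + Z by rewrite XE subrK.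
by apply/colP => i; rewrite !mxE linearD.
Qed.

End LinearPerturbation.

Theorem theorem4p1 (R : realType) (n m N : nat)
    (A : 'M[complex R]_n) (B : 'M[complex R]_m) (C : 'M[complex R]_(n, m))
    (E : 'I_N -> 'M[complex R]_(n, m))
    (Wf : 'I_N -> {scalar 'M[complex R]_(n, m)})
    (heig : eig A `&` eig (- B) = set0)
    (hsol : exists! X : 'M[complex R]_(n, m),
        sylvester A B X + lowrank_op Wf E X = C) :
  let G := sylvester_inv A B C in
  let F := fun k => sylvester_inv A B (E k) in
  let W := coupling_mx Wf F in
  let g := functional_col Wf G in
  exists a : 'cV[complex R]_N,
    unique (fun b : 'cV[complex R]_N => W *m b = g) a /\
    (forall X : 'M[complex R]_(n, m),
        sylvester A B X + lowrank_op Wf E X = C <->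
        X = sylvester_inv A B (C - \sum_k a k 0 *: E k)).
Proof.
move=> G F W g; case: hsol => X0 [X0sol X0uniq].
(* Adding a kernel element [Y] to [X0] gives another solution, which must be [X0] itself. *)
have ker0 Y : sylvester A B Y + lowrank_op Wf E Y = 0 -> Y = 0.
  move=> Y0; apply: (addrI X0); rewrite addr0; symmetry; apply: X0uniq.
  by rewrite !linearD /= addrACA X0sol Y0 addr0.
have [X0E Wa] := perturbed_solution heig X0sol.
exists (functional_col Wf X0); split.
  split=> // b Wb; apply: (coupling_mx_inj heig ker0).
  exact: etrans Wa (esym Wb).
(* The closed formula evaluates to [X0], so the equivalence is just uniqueness of the solution. *)
by move=> X; rewrite -X0E; split=> [/X0uniq|->].
Qed.
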